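(* For each positive integer $n$, let $a(n)$ be the number of $4 \times 2n$ matrices with entries in $\{0,1\}$ such that every row contains exactly $n$ ones and every column contains exactly $2$ ones. Then for all positive integers $n$, $$36(2n+3)(2n+1)(n+1)\,a(n) - 2(2n+3)\left(10n^2+30n+23\right)a(n+1) + (n+2)^3\,a(n+2) = 0.$$ *)

(* Defs.v *)
From HB Require Import structures.
From mathcomp Require Import all_boot all_order all_algebra.

Set Implicit Arguments.
Unset Strict Implicit.
Unset Printing Implicit Defensive.

(* An entry [true] stands for 1 and [false] for 0. *)
Definition a (n : nat) : nat :=
  #|[set A : 'M[bool]_(4, 2 * n) |
      [forall i : 'I_4, #|[set j | A i j]| == n]
      && [forall j : 'I_(2 * n), #|[set i | A i j]| == 2]]|.

(* Main.v *)
(** Since every column has two ones, the last row is determined by the first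
three, S, T and U, seen as sets of n columns; the only constraint is that U
contains the complement of S ∪ T and avoids S ∩ T. If T \ S has k elements,
there are C(n,k)^2 such T for a given S, and then C(2k,k) choices of U. Hence
a(n) = C(2n,n) b(n) with b(n) = sum_k C(n,k)^2 C(2k,k), which is also the sum of
the squares of the trinomial coefficients of order n. Zeilberger's method gives
(n+2)^2 b(n+2) - (10n^2+30n+23) b(n+1) + 9(n+1)^2 b(n) = 0, and the recurrence
for a follows from (n+1) C(2n+2,n+1) = 2(2n+1) C(2n,n). *)

Require Import Defs.
From HB Require Import structures.
From mathcomp Require Import all_boot all_order all_algebra.
From mathcomp Require Import ring lra zify.

Set Implicit Arguments.
Unset Strict Implicit.
Unset Printing Implicit Defensive.

Import Order.TTheory GRing.Theory Num.Theory.
Local Open Scope ring_scope.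

Definition squared_trinomial_sum (n : nat) : nat :=
  (\sum_(k < n.+1) 'C(n, k) ^ 2 * 'C(k.*2, k))%N.

(** * Counting subsets with prescribed traces or bounds *)

(** [X] corresponds to the pair [(X :&: S, X :\: S)], whose components are chosen independently
    inside [S] and [~: S]. *)
Lemma card_sets_traces (T : finType) (S : {set T}) (i j : nat) :
  #|[set X : {set T} | (#|X :&: S| == i) && (#|X :\: S| == j)]|
  = ('C(#|S|, i) * 'C(#|~: S|, j))%N.
Proof.
rewrite -!cards_draws -cardsX.
rewrite -(card_imset _ (f := fun X => (X :&: S, X :\: S))); last first.
  by move=> X Y [XY1 XY2]; rewrite -(setID X S) XY1 XY2 setID.
congr #|pred_of_set _|; apply/setP=> -[A B]; rewrite !inE /=.
apply/imsetP/andP.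
  move=> [X]; rewrite inE => /andP[Xi Xj] [-> ->].
  by rewrite Xi Xj subsetIr setDE subsetIr.
move=> [/andP[AS Ai] /andP[BS Bj]]; exists (A :|: B).
  have BS0 : B :&: S = set0 by apply: disjoint_setI0; rewrite disjoints_subset.
  have AS0 : A :\: S = set0 by apply/eqP; rewrite setD_eq0.
  rewrite inE setIUl setDUl BS0 AS0 setU0 set0U (setIidPl AS) Ai.
  by rewrite setDE (setIidPl BS).
have BS0 : B :&: S = set0 by apply: disjoint_setI0; rewrite disjoints_subset.
have AS0 : A :\: S = set0 by apply/eqP; rewrite setD_eq0.
rewrite setIUl setDUl BS0 AS0 setU0 set0U (setIidPl AS).
by rewrite setDE (setIidPl BS).
Qed.

(** The map [X => A :|: X] is a bijection from the [m]-subsets of [B :\: A] onto these sets, with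
    inverse [U => U :\: A]. *)
Lemma card_sets_between (T : finType) (A B : {set T}) (m : nat) :
  A \subset B ->
  #|[set U : {set T} | [&& A \subset U, U \subset B & #|U| == #|A| + m]%N]|
  = 'C(#|B :\: A|, m).
Proof.
move=> AB; rewrite -cards_draws.
rewrite -[RHS](card_in_imset (f := fun X => A :|: X)); last first.
  have UK (X : {set T}) : X \subset B :\: A -> (A :|: X) :\: A = X.
    rewrite subsetD => /andP[_ XA]; rewrite setDUl setDv set0U.
    by apply/setDidPl.
  move=> X Y; rewrite !inE => /andP[/UK XA _] /andP[/UK YA _] XY.
  by rewrite -XA XY YA.
congr #|pred_of_set _|; apply/setP=> U; rewrite inE.
apply/and3P/imsetP.
  move=> [AU UB /eqP Um]; exists (U :\: A); last first.
    by rewrite -{1}(setID U A) (setIidPr AU).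
  by rewrite inE setSD //= cardsD (setIidPr AU) Um addKn.
move=> [X]; rewrite inE subsetD => /andP[/andP[XB XA] /eqP Xm] ->; split.
- exact: subsetUl.
- by rewrite subUset AB.
- by rewrite cardsU setIC (disjoint_setI0 XA) cards0 subn0 Xm.
Qed.

Lemma card_set_pairs (I J : finType) (P : pred (I * J)) :
  #|[set p | P p]| = (\sum_i #|[set j | P (i, j)]|)%N.
Proof.
rewrite -sum1dep_card.
under [RHS]eq_bigr do rewrite -sum1dep_card.
by rewrite pair_big_dep; apply: eq_bigl => -[].
Qed.

(** * Binomial identities and the recurrence for [squared_trinomial_sum] *)

Lemma bin_central_succ (m : nat) :
  (m.+1 * 'C(m.+1.*2, m.+1) = 2 * (m.*2.+1) * 'C(m.*2, m))%N.
Proof.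
(* The two identities are linked through C(2m+1, m), which gets eliminated. *)
have := mul_bin_diag m.*2.+2 m; have := mul_bin_down m.*2.+1 m.
rewrite doubleS -addnn /=; have -> : ((m + m).+1 - m = m.+1)%N by lia.
nia.
Qed.

Lemma intQS (k : nat) : k.+1%:Q = k%:Q + 1.
Proof. by rewrite -addn1 PoszD rmorphD. Qed.

Lemma bin_central_succQ (m : nat) :
  'C(m.+1.*2, m.+1)%:Q = 2 * (2 * m%:Q + 1) * 'C(m.*2, m)%:Q / (m%:Q + 1).
Proof.
have m0 : 0 <= m%:Q by rewrite ler0z.
have m1 : m%:Q + 1 != 0 by apply: lt0r_neq0; lra.
have dbl : m.*2%:Q = 2 * m%:Q by rewrite -mul2n PoszM rmorphM.
have /(congr1 (fun x : nat => x%:Q)) := bin_central_succ m.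
rewrite !PoszM !rmorphM /= !intQS dbl => E.
by apply: (mulfI m1); rewrite [RHS]mulrC mulfVK //; lra.
Qed.

(** Over the rationals the subtraction is not truncated; for [k] above [n.+1] both binomials
    vanish. *)
Lemma mul_bin_downQ (n k : nat) :
  (n%:Q + 1) * 'C(n, k)%:Q = (n%:Q + 1 - k%:Q) * 'C(n.+1, k)%:Q.
Proof.
case: (leqP k n.+1) => [kn|nk]; last by rewrite !bin_small ?mulr0 // ltnW.
have /(congr1 (fun x : nat => x%:Q)) := mul_bin_down n.+1 k.
by rewrite !PoszM !rmorphM /= -subzn // rmorphB /= -addn1 PoszD rmorphD.
Qed.

(* Zeilberger's method: the summand of the recurrence is [G k.+1 - G k] for
   [G k = k (3 k - 4 n - 8) 'C(n.+1, k.-1) ^ 2 'C(2 k, k)]. *)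
Lemma squared_trinomial_partial_sum (n m : nat) :
  \sum_(k < m.+1) ((n%:Q + 2) ^+ 2 * 'C(n.+2, k)%:Q ^+ 2
     - (10 * n%:Q ^+ 2 + 30 * n%:Q + 23) * 'C(n.+1, k)%:Q ^+ 2
     + 9 * (n%:Q + 1) ^+ 2 * 'C(n, k)%:Q ^+ 2) * 'C(k.*2, k)%:Q
  = 2 * (2 * m%:Q + 1) * (3 * m%:Q - 4 * n%:Q - 5)
    * 'C(n.+1, m)%:Q ^+ 2 * 'C(m.*2, m)%:Q.
Proof.
elim: m => [|m IHm].
  by rewrite big_ord1 !bin0; ring.
rewrite big_ord_recr /= {}IHm.
have n0 : 0 <= n%:Q by rewrite ler0z.
have m0 : 0 <= m%:Q by rewrite ler0z.
have n1 : n%:Q + 1 != 0 by apply: lt0r_neq0; lra.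
have n2 : n%:Q + 2 != 0 by apply: lt0r_neq0; lra.
have m1 : m%:Q + 1 != 0 by apply: lt0r_neq0; lra.
(* All binomials are reduced to C(n+2, m+1) and C(2m, m), so that the induction step becomes an
   identity of rational functions. *)
have c1 : 'C(n.+1, m.+1)%:Q
          = (n%:Q + 1 - m%:Q) * 'C(n.+2, m.+1)%:Q / (n%:Q + 2).
  have := mul_bin_downQ n.+1 m.+1; rewrite !intQS => E.
  by apply: (mulfI n2); rewrite [RHS]mulrC mulfVK //; lra.
have c0 : 'C(n, m.+1)%:Q = (n%:Q - m%:Q) * 'C(n.+1, m.+1)%:Q / (n%:Q + 1).
  have := mul_bin_downQ n m.+1; rewrite !intQS => E.
  by apply: (mulfI n1); rewrite [RHS]mulrC mulfVK //; lra.
have d1 : 'C(n.+1, m)%:Q = (m%:Q + 1) * 'C(n.+2, m.+1)%:Q / (n%:Q + 2).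
  have /(congr1 (fun x : nat => x%:Q)) := mul_bin_diag n.+2 m.
  rewrite /= !PoszM !rmorphM /= !intQS => E.
  by apply: (mulfI n2); rewrite [RHS]mulrC mulfVK //; lra.
rewrite c0 c1 d1 bin_central_succQ intQS; field.
by rewrite n1 n2 m1.
Qed.

(** The added terms contain C(n, k) with k > n. This brings the three sums of the recurrence to one
    range. *)
Lemma squared_trinomial_sum_widen (n m : nat) : (n <= m)%N ->
  squared_trinomial_sum n = (\sum_(k < m.+1) 'C(n, k) ^ 2 * 'C(k.*2, k))%N.
Proof.
move=> nm; rewrite /squared_trinomial_sum.
rewrite (big_ord_widen m.+1 (fun k => 'C(n, k) ^ 2 * 'C(k.*2, k))%N) //.
rewrite [RHS](bigID (fun k : 'I__ => k < n.+1)%N) /=.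
rewrite [X in (_ + X)%N]big1 ?addn0 // => k; rewrite -leqNgt => nk.
by rewrite bin_small.
Qed.

Lemma squared_trinomial_sum_recurrence (n : nat) :
  (n%:Q + 2) ^+ 2 * (squared_trinomial_sum n.+2)%:Q
  - (10 * n%:Q ^+ 2 + 30 * n%:Q + 23) * (squared_trinomial_sum n.+1)%:Q
  + 9 * (n%:Q + 1) ^+ 2 * (squared_trinomial_sum n)%:Q = 0.
Proof.
have sumQ p : (p <= n.+2)%N -> (squared_trinomial_sum p)%:Q
    = \sum_(k < n.+3) 'C(p, k)%:Q ^+ 2 * 'C(k.*2, k)%:Q.
  move=> /squared_trinomial_sum_widen ->.
  rewrite (big_morph Posz PoszD (erefl _)) rmorph_sum /=.
  by apply: eq_bigr => k _; rewrite PoszM rmorphM -mulnn PoszM rmorphM.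
rewrite (sumQ n) 1?ltnW // (sumQ n.+1) // (sumQ n.+2) // !mulr_sumr.
rewrite -sumrB -big_split /=.
(* At this upper end the closed form has the factor C(n+1, n+2) = 0. *)
have := squared_trinomial_partial_sum n n.+2.
rewrite [X in _ = X -> _](_ : _ = 0); last first.
  by rewrite (@bin_small n.+1) // expr0n /= !(mulr0, mul0r).
by move=> sum0; rewrite -[RHS]sum0; apply: eq_bigr => k _; ring.
Qed.

(** * From matrices to triples of rows *)

(** Three entries of a column can be completed by a fourth to exactly two ones if and only if their
    sum is 1 or 2. *)
Definition neither_empty_nor_full (J : finType) (S T U : {set J}) : bool :=
  [forall j, 0 < (j \in S) + (j \in T) + (j \in U) < 3]%N.

(** For fixed [S] and [T], this puts [U] in an interval of sets, the form that [card_sets_between]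
    counts. *)
Lemma neither_empty_nor_fullE (J : finType) (S T U : {set J}) :
  neither_empty_nor_full S T U
  = (~: (S :|: T) \subset U) && (U \subset ~: (S :&: T)).
Proof.
apply/forallP/andP=> [STU|[/subsetP STU /subsetP UST] j].
  by split; apply/subsetP=> j; move/(_ j): STU; rewrite !inE;
    case: (j \in S); case: (j \in T); case: (j \in U).
move: (STU j) (UST j); rewrite !inE.
by case: (j \in S); case: (j \in T); case: (j \in U) => //= A B;
  try (have := A isT); try (have := B isT).
Qed.

Definition row_set (n : nat) (A : 'M[bool]_(4, 2 * n)) (i : 'I_4) :=
  [set j | A i j].

Lemma a_triples (n : nat) :
  a n = #|[set p : {set 'I_(2 * n)} * ({set 'I_(2 * n)} * {set 'I_(2 * n)}) |
    [&& #|p.1| == n, #|p.2.1| == n, #|p.2.2| == n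
      & neither_empty_nor_full p.1 p.2.1 p.2.2]]|.
Proof.
pose i0 : 'I_4 := ord0; pose i1 : 'I_4 := lift ord0 ord0.
pose i2 : 'I_4 := lift ord0 (lift ord0 ord0).
pose i3 : 'I_4 := ord_max.
have sum4 (F : 'I_4 -> nat) : (\sum_i F i = F i0 + F i1 + F i2 + F i3)%N.
  rewrite !big_ord_recl big_ord0 addn0 !addnA.
  by congr (_ + F _)%N; apply: val_inj.
have colE (A : 'M[bool]_(4, 2 * n)) j :
    #|[set i | A i j]| = (A i0 j + A i1 j + A i2 j + A i3 j)%N.
  by rewrite -sum1dep_card big_mkcond sum4; do 4 case: (A _ j).
pose rows (A : 'M[bool]_(4, 2 * n)) :=
  (row_set A i0, (row_set A i1, row_set A i2)).
have all4 (P : pred 'I_4) : P i0 -> P i1 -> P i2 -> P i3 -> forall i, P i.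
  move=> P0 P1 P2 P3 [[|[|[|[|//]]]] ?].
  - by rewrite (_ : Ordinal _ = i0) //; apply: val_inj.
  - by rewrite (_ : Ordinal _ = i1) //; apply: val_inj.
  - by rewrite (_ : Ordinal _ = i2) //; apply: val_inj.
  - by rewrite (_ : Ordinal _ = i3) //; apply: val_inj.
rewrite /a -[LHS](card_in_imset (f := rows)); last first.
  move=> A B; rewrite !inE => /andP[_ /forallP colA] /andP[_ /forallP colB].
  move=> [/setP E0 /setP E1 /setP E2]; apply/matrixP=> i j; apply/eqP.
  move: i; apply: all4; move: (E0 j) (E1 j) (E2 j) (colA j) (colB j);
    rewrite !inE !colE => -> -> -> // /eqP eA /eqP eB.
  (* Both column sums are 2 and the first three entries agree, so the fourth ones do too. *)
  by move: (etrans eA (esym eB)) => /addnI; case: (A i3 j); case: (B i3 j).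
congr #|pred_of_set _|; apply/setP=> -[S [T U]]; rewrite inE /=.
apply/imsetP/and4P.
  move=> [A]; rewrite inE => /andP[/forallP rowA /forallP colA] [-> -> ->].
  split; rewrite ?rowA //; apply/forallP=> j; move: (colA j).
  by rewrite colE !inE; do 4 case: (A _ j).
move=> [/eqP Sn /eqP Tn /eqP Un /forallP STU].
(* The last row has a one exactly where the other three have a single one. *)
pose A : 'M[bool]_(4, 2 * n) := \matrix_(i, j)
  if i == i0 then j \in S else if i == i1 then j \in T else
  if i == i2 then j \in U else ((j \in S) + (j \in T) + (j \in U) < 2)%N.
have A0 j : A i0 j = (j \in S) by rewrite mxE.
have A1 j : A i1 j = (j \in T) by rewrite mxE.
have A2 j : A i2 j = (j \in U) by rewrite mxE.
have A3 j : A i3 j = ((j \in S) + (j \in T) + (j \in U) < 2)%N by rewrite mxE.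
have R0 : row_set A i0 = S by apply/setP=> j; rewrite inE A0.
have R1 : row_set A i1 = T by apply/setP=> j; rewrite inE A1.
have R2 : row_set A i2 = U by apply/setP=> j; rewrite inE A2.
exists A; last by rewrite /rows R0 R1 R2.
have colA j : #|[set i | A i j]| = 2%N.
  rewrite colE A0 A1 A2 A3; move: (STU j).
  by case: (j \in S); case: (j \in T); case: (j \in U).
rewrite inE; apply/andP; split; last by apply/forallP=> j; rewrite colA.
(* Double counting: the 2n columns hold 4n ones, and three rows use 3n of them, which leaves n for
   the last row. *)
have total : (\sum_i #|row_set A i| = 4 * n)%N.
  under eq_bigr do rewrite -sum1dep_card big_mkcond.
  rewrite exchange_big /=.
  under eq_bigr do rewrite -big_mkcond sum1dep_card colA.
  by rewrite sum_nat_const card_ord; lia.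
rewrite sum4 R0 R1 R2 Sn Tn Un in total.
apply/forallP; apply: all4; rewrite -/(row_set A _) ?R0 ?R1 ?R2 ?Sn ?Tn ?Un //.
by rewrite -(eqn_add2l (n + n + n)) total; apply/eqP; lia.
Qed.

(** * Counting the triples *)

Lemma card_row_triples (J : finType) (n : nat) : #|J| = n.*2 ->
  #|[set p : {set J} * ({set J} * {set J}) |
    [&& #|p.1| == n, #|p.2.1| == n, #|p.2.2| == n
      & neither_empty_nor_full p.1 p.2.1 p.2.2]]|
  = ('C(n.*2, n) * squared_trinomial_sum n)%N.
Proof.
move=> cardJ; rewrite card_set_pairs /=.
rewrite (bigID (fun S : {set J} => #|S| == n)) /=.
rewrite [X in (_ + X)%N]big1 ?addn0 => [|S /negbTE Sn]; last first.
  by rewrite Sn; apply/eqP; rewrite cards_eq0; apply/eqP/setP=> p; rewrite !inE.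
have -> : 'C(n.*2, n) = #|[set S : {set J} | #|S| == n]|.
  by rewrite card_draws cardJ.
rewrite -sum1dep_card big_distrl /=; apply: eq_bigr => S /eqP Sn.
rewrite mul1n Sn eqxx /=.
have SCn : #|~: S| = n by rewrite cardsCs setCK cardJ Sn -addnn addnK.
have TSC (T : {set J}) : (#|T :\: S| < n.+1)%N.
  by have := subset_leq_card (subsetIr T (~: S)); rewrite -setDE SCn ltnS.
rewrite card_set_pairs /=.
rewrite (bigID (fun T : {set J} => #|T| == n)) /=.
rewrite [X in (_ + X)%N]big1 ?addn0 => [|T /negbTE Tn]; last first.
  by rewrite Tn; apply/eqP; rewrite cards_eq0; apply/eqP/setP=> p; rewrite !inE.
(* By [TSC] the size of [T :\: S] is at most [n], so [inord] keeps its value. *)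
rewrite (partition_big (fun T => inord #|T :\: S| : 'I_n.+1) predT) //=.
apply: eq_bigr => k _.
have kn : (k <= n)%N by rewrite -ltnS.
(* One factor counts [T :\: S], the other [T :&: S], as C(n, n-k) = C(n, k). *)
have -> : ('C(n, k) ^ 2 = #|[set T : {set J} |
      (#|T :&: S| == n - k)%N && (#|T :\: S| == k)]|)%N.
  by rewrite card_sets_traces Sn SCn bin_sub // mulnn.
rewrite -sum1dep_card big_distrl /=.
apply: eq_big => [T|T /andP[/eqP Tn /eqP Tk]].
  have TS := cardsID S T.
  rewrite -(inj_eq val_inj) /= inordK //.
  case: (#|T :\: S| =P k) => [Tk|]; rewrite ?andbF //.
  by rewrite !andbT -TS Tk -[RHS](eqn_add2r k) subnK.
have {Tk} TDk : #|T :\: S| = k.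
  by rewrite -Tk inordK.
have Tk := cardsID S T.
have IS : #|S :&: T| = (n - k)%N.
  by rewrite setIC; apply/eqP; rewrite -(eqn_add2r k) -{1}TDk Tk Tn subnK.
have UST : #|S :|: T| = (n + k)%N.
  by rewrite cardsU IS Sn Tn; lia.
have CST : #|~: (S :|: T)| = (n - k)%N by rewrite cardsCs setCK cardJ UST; lia.
have IST : #|~: (S :&: T)| = (n + k)%N.
  by rewrite cardsCs setCK cardJ IS; lia.
have sub : ~: (S :|: T) \subset ~: (S :&: T).
  by rewrite setCS subIset // subsetUl.
rewrite mul1n Tn eqxx /=.
(* [U] contains the n-k forced elements and takes its other k among these 2k. *)
have -> : k.*2 = #|~: (S :&: T) :\: ~: (S :|: T)|.
  by rewrite cardsD (setIidPr sub) CST IST; lia.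
rewrite -card_sets_between // CST subnK //.
congr #|pred_of_set _|; apply/setP=> U; rewrite !inE neither_empty_nor_fullE.
by rewrite andbC andbA.
Qed.

Lemma a_binE (n : nat) : a n = ('C(n.*2, n) * squared_trinomial_sum n)%N.
Proof. by rewrite a_triples card_row_triples // card_ord mul2n. Qed.

Theorem theorem4 (n : nat) (hn : (0 < n)%N) :
  36 * (2 * n%:Z + 3) * (2 * n%:Z + 1) * (n%:Z + 1) * (a n)%:Z
  - 2 * (2 * n%:Z + 3) * (10 * n%:Z ^+ 2 + 30 * n%:Z + 23) * (a (n + 1)%N)%:Z
  + (n%:Z + 2) ^+ 3 * (a (n + 2)%N)%:Z = 0.
Proof.
have n0 : 0 <= n%:Q by rewrite ler0z.
have n1 : n%:Q + 1 != 0 by apply: lt0r_neq0; lra.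
have n2 : n%:Q + 2 != 0 by apply: lt0r_neq0; lra.
have aQ (m : nat) :
    (a m)%:Q = 'C(m.*2, m)%:Q * (squared_trinomial_sum m)%:Q.
  by rewrite a_binE PoszM rmorphM.
have recQ : 36 * (2 * n%:Q + 3) * (2 * n%:Q + 1) * (n%:Q + 1) * (a n)%:Q
  - 2 * (2 * n%:Q + 3) * (10 * n%:Q ^+ 2 + 30 * n%:Q + 23) * (a n.+1)%:Q
  + (n%:Q + 2) ^+ 3 * (a n.+2)%:Q = 0.
  have := squared_trinomial_sum_recurrence n.
  rewrite !aQ !bin_central_succQ !intQS => rec.
  (* Once the central binomials are reduced to C(2n, n), the goal is [rec] times this factor. *)
  rewrite -[RHS](mulr0 (4 * (2 * n%:Q + 3) * (2 * n%:Q + 1)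
                        * 'C(n.*2, n)%:Q / (n%:Q + 1))) -rec.
  field; rewrite n1 /=.
  by apply: lt0r_neq0; lra.
rewrite addn1 addn2; apply: (@intr_inj rat).
by apply: etrans recQ; ring.
Qed.
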